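(* Let $(x_n)_{n\geq 1}$ be a sequence in $[0,1)$, and suppose that there exists a function $F : \mathbb{N} \times \mathbb{N} \rightarrow \mathbb{R}^+$ which is monotonically increasing in its first argument, and which satisfies $$\max_{s=1, \ldots , K} \left| \frac{1}{2s} \# \left\{ 1 \leq l \neq m \leq N \, : \, \|x_l-x_m\| < \frac{s}{N} \right\} - N \right| \leq F(K,N)$$ for all $N \in \mathbb{N}$ and all $K \in \mathbb{N}$ with $K\leq N/2$. Then there exists an integer $N_0>0$ such that for every $N\in \mathbb{N}$ with $N\geq N_0$, and every $K \in \mathbb{N}$ satisfying $$\min \left(\frac{1}{2} N^{2/5}, \frac{N}{F\left(K^{2} , N\right)}\right) \leq K \leq N^{2/5},$$ we have $$N D_{N}^{*} \leq 5 \cdot \max \left(N^{4/5}, \sqrt{N \cdot F \left(K^{2}, N\right)}\right),$$ where $D_N^*$ is the star-discrepancy of $(x_n)_{n \geq 1}$.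
   Context: $\mathbb{N}$ denotes the positive integers and $\mathbb{R}^+$ the positive real numbers. For a real number $y$, $\|y\|$ denotes the distance from $y$ to the nearest integer. The set $\{1 \leq l \neq m \leq N : \ldots\}$ consists of ordered pairs $(l,m)$ of distinct indices in $\{1,\ldots,N\}$, and $\#$ denotes cardinality. The maximum over $s=1,\ldots,K$ is over integers $s$. ''Monotonically increasing in its first argument'' is meant in the non-strict sense: $F(K,N)\leq F(K',N)$ whenever $K\leq K'$. The star-discrepancy of $(x_n)_{n\geq 1}$ is $$D_N^* = \sup_{0 \leq a \leq 1} \left| \frac{1}{N} \cdot A_N\left( [0,a)\right) - a \right|, \qquad A_N([0,a)) := \# \{ 1 \leq n \leq N \, : \, x_n \in [0,a) \}.$$ *)

(* Defs.v *)
From mathcomp Require Import all_boot all_order all_algebra.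
From mathcomp Require Import all_classical all_reals all_analysis.

Set Implicit Arguments.
Unset Strict Implicit.
Unset Printing Implicit Defensive.

Import Order.TTheory GRing.Theory Num.Theory.
Local Open Scope classical_set_scope.
Local Open Scope ring_scope.

(* A sequence (x_n)_{n >= 1} is a function [x : nat -> R] whose value at 0 is
   never used: the index n in {1, ..., N} is [i.+1] for [i : 'I_N]. *)

Definition nearest_int_dist (R : realType) (y : R) : R :=
  inf [set `|y - k%:~R| | k in [set: int]].

Definition pair_count (R : realType) (x : nat -> R) (N s : nat) : nat :=
  #|[pred p : 'I_N * 'I_N | (p.1 != p.2) &&
      (nearest_int_dist (x p.1.+1 - x p.2.+1) < s%:R / N%:R)]|.

(* The default value 0 of the iterated maximum is harmless: every term is
   nonnegative, and the range is nonempty as soon as 0 < K. *)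
Definition pair_deviation (R : realType) (x : nat -> R) (K N : nat) : R :=
  \big[Num.max/0]_(1 <= s < K.+1)
    `| 1 / (2 * s%:R) * (pair_count x N s)%:R - N%:R |.

Definition visit_count (R : realType) (x : nat -> R) (N : nat) (a : R) : nat :=
  #|[pred i : 'I_N | (0 <= x i.+1) && (x i.+1 < a)]|.

Definition star_discrepancy (R : realType) (x : nat -> R) (N : nat) : R :=
  sup [set `| 1 / N%:R * (visit_count x N a)%:R - a |
        | a in [set a : R | 0 <= a <= 1]].

(* Main.v *)
Require Import Defs.
From mathcomp Require Import all_boot all_order all_algebra.
From mathcomp Require Import all_classical all_reals all_analysis.
From mathcomp Require Import zify ring lra.

(** Fix N and put L = K^2. Cut the circle into N boxes of length 1/N, let
    S_j be the number of points in the arc formed by the L consecutive boxes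
    that start at box j, and let V be the sum over j of (S_j - L)^2.

    Pair correlations bound V. Each point lies in L arcs, so the S_j have mean
    L. The sum of the S_j^2 counts the arcs that contain both points of an
    ordered pair, summed over the pairs. Two points contained in m common arcs
    are at distance less than s/N for at least m of the values s = 1, ..., L
    ([leq_arcs_through_pair]), so the sum of the S_j^2 is at most NL plus the
    sum over s <= L of the pair counts at scale s/N. The hypothesis bounds each
    of these by 2s(N + F); the main terms add up to N L (L + 1), and the NL^2
    in it cancels against the square of the mean. What is left is
    V <= 2LN + L(L+1)F ([sum_sq_dev_box_le]).

    V bounds the discrepancy. The arcs inside a block of consecutive boxes
    cover each point at most L times, so L times the number of points in the
    block is at least the sum of their S_j, and Cauchy-Schwarz bounds the
    deviation of that sum from its expected value by sqrt(N V). This gives a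
    lower bound for the number of points in any block ([interval_count_ge]).
    Applied to [0, a) and to its complement [a, 1), it gives
    N D_N^* <= L + sqrt(N V) / L ([star_discrepancy_le]).

    Write M for the maximum on the right-hand side of the theorem. The upper
    bound on K gives L <= N^(4/5) <= M. The lower bound on K gives N <= M K in
    both cases of the minimum, and then sqrt(N V) <= 2 M L
    ([arc_scale_bound]). Hence N D_N^* <= 3 M. Taking N >= 32 ensures
    N^(1/5) >= 2, which provides 2 L <= N and N <= M K. *)

Set Implicit Arguments.
Unset Strict Implicit.
Unset Printing Implicit Defensive.

Import Order.TTheory GRing.Theory Num.Theory.
Local Open Scope ring_scope.

(** * Arcs on a cyclic set of boxes *)

Lemma val_subZp n (a c : 'I_n.+1) :
  (a - c)%R = (if (c <= a)%N then a - c else n.+1 + a - c)%N :> nat.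
Proof.
have ha := ltn_ord a; have hc := ltn_ord c.
rewrite /= modnDmr; case: leqP => h.
  by rewrite (_ : (a + (n.+1 - c) = (a - c) + n.+1)%N) ?modnDr ?modn_small; lia.
by rewrite modn_small; lia.
Qed.

Lemma val_subZp_add n (a c : 'I_n.+1) :
  ((a - c)%R + c = a \/ (a - c)%R + c = a + n.+1 :> nat)%N.
Proof.
have hc := ltn_ord c; rewrite val_subZp; case: leqP => h; [left | right]; lia.
Qed.

(** The arc of length [L] starting at [j] is {j, j+1, ..., j+L-1} modulo
    [n.+1]; membership of [c] is encoded as [c - j < L], with a subtraction in
    the cyclic group ['I_n.+1]. *)
Definition arc_count n (I : finType) (b : I -> 'I_n.+1) (L : nat)
  (j : 'I_n.+1) : nat := #|[pred i | ((b i - j)%R < L)%N]|.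

Lemma card_predE (T : finType) (P : pred T) : #|P| = (\sum_x (P x : nat))%N.
Proof. by rewrite -sum1_card big_mkcond; apply: eq_bigr => x _; rewrite unfold_in; case: (P x). Qed.

Lemma sum_arcs_through_point n (a : 'I_n.+1) (L : nat) : (L <= n.+1)%N ->
  (\sum_(j : 'I_n.+1) (((a - j)%R < L) : nat) = L)%N.
Proof.
move=> hL.
rewrite (reindex_inj (h := fun c : 'I_n.+1 => (a - c)%R)); last first.
  by move=> c c' /addrI/oppr_inj.
under eq_bigr do rewrite subKr.
rewrite -[RHS]card_ord -sum1_card (big_ord_widen _ (fun=> 1%N) hL) [RHS]big_mkcond.
by apply: eq_bigr => c _; case: ltnP.
Qed.

(** An arc starting at [j] that contains both [a] and [c] is charged to the
    integer [maxn (a - j) (c - j) < L], the offset of the farther point. The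
    charge is injective: (a - j) - (c - j) is a - c modulo [n.+1] and lies
    strictly between -L and L, so [L + L <= n.+1] makes it an integer that does
    not depend on [j]. Hence the larger offset determines both offsets, and
    with them [j]. [P s] stands for the two points being closer than (s+1)
    box lengths. *)
Lemma leq_arcs_through_pair n (a c : 'I_n.+1) (L : nat) (P : pred nat) :
  (L + L <= n.+1)%N ->
  (forall j : 'I_n.+1, ((a - j)%R < L)%N -> ((c - j)%R < L)%N ->
     P (maxn (a - j)%R (c - j)%R)) ->
  (\sum_(j : 'I_n.+1) ((((a - j)%R < L) && ((c - j)%R < L)) : nat)
     <= \sum_(s < L) P s)%N.
Proof.
case: L => [|L] hL hP; first by rewrite big1 ?big_ord0.
rewrite -(card_predE (fun j : 'I_n.+1 => ((a - j)%R < L.+1) && ((c - j)%R < L.+1)))%N.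
rewrite -(card_predE (fun s : 'I_L.+1 => P s)).
pose f (j : 'I_n.+1) : 'I_L.+1 := inord (maxn (a - j)%R (c - j)%R).
have fE (j : 'I_n.+1) : ((a - j)%R < L.+1)%N -> ((c - j)%R < L.+1)%N ->
    f j = maxn (a - j)%R (c - j)%R :> nat.
  by move=> h1 h2; rewrite inordK //; lia.
rewrite -(@card_in_imset _ _ f).
  apply: subset_leq_card; apply/fintype.subsetP => s /imsetP[j].
  by rewrite !unfold_in => /andP[h1 h2] ->; rewrite fE // hP.
move=> j j'; rewrite !unfold_in => /andP[h1 h2] /andP[h3 h4] /(congr1 val) /=.
rewrite !fE // => e.
have hu := val_subZp_add a j; have hv := val_subZp_add c j.
have hw := val_subZp_add a j'; have hz := val_subZp_add c j'.
(* Both differences of offsets are congruent to a - c and shorter than half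
   a turn, hence equal as integers. *)
have e2 : ((a - j)%R + (c - j')%R = (a - j')%R + (c - j)%R :> nat)%N.
  move: hL hu hv hw hz h1 h2 h3 h4; clear.
  move: (nat_of_ord (a - j)%R) (nat_of_ord (c - j)%R) => u v.
  move: (nat_of_ord (a - j')%R) (nat_of_ord (c - j')%R) => w z.
  move: (nat_of_ord a) (nat_of_ord c) (nat_of_ord j) (nat_of_ord j').
  by move=> ? ? ? ? ? [] ? [] ? [] ? [] ?; lia.
have : (a - j)%R = (a - j')%R by apply: ord_inj; move: e e2; clear; lia.
by move=> /addrI/oppr_inj.
Qed.

Lemma sum_arc_count n (I : finType) (b : I -> 'I_n.+1) (L : nat) :
  (L <= n.+1)%N -> (\sum_j arc_count b L j = #|I| * L)%N.
Proof.
move=> hL; rewrite -sum_nat_const.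
under eq_bigr do rewrite /arc_count card_predE.
by rewrite exchange_big /=; apply: eq_bigr => i _; rewrite sum_arcs_through_point.
Qed.

(** Expanding the squares counts triples (i, k, j) such that the arc at [j]
    contains the points [i] and [k]; the diagonal i = k contributes the term
    [#|I| * L], and [leq_arcs_through_pair] handles the rest. *)
Lemma sum_arc_count_sq n (I : finType) (b : I -> 'I_n.+1) (L : nat)
    (P : I * I -> pred nat) :
  (L + L <= n.+1)%N ->
  (forall (p : I * I) (j : 'I_n.+1),
     ((b p.1 - j)%R < L)%N -> ((b p.2 - j)%R < L)%N ->
     P p (maxn (b p.1 - j)%R (b p.2 - j)%R)) ->
  (\sum_j arc_count b L j ^ 2 <= #|I| * L +
     \sum_(s < L) #|[pred p : I * I | (p.1 != p.2) && P p s]|)%N.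
Proof.
move=> hL hP.
pose J i k := (\sum_(j : 'I_n.+1) ((((b i - j)%R < L) && ((b k - j)%R < L)) : nat))%N.
have -> : (\sum_j arc_count b L j ^ 2 = \sum_i \sum_k J i k)%N.
  under eq_bigr do rewrite /arc_count card_predE -mulnn big_distrlr /=.
  rewrite exchange_big; apply: eq_bigr => i _.
  rewrite exchange_big; apply: eq_bigr => k _.
  by apply: eq_bigr => j _; rewrite mulnb.
have -> : (\sum_i \sum_k J i k =
    \sum_i J i i + \sum_(p : I * I | p.1 != p.2) J p.1 p.2)%N.
  rewrite -(pair_big_dep xpredT (fun i k => i != k) J) -big_split /=; apply: eq_bigr => i _.
  by rewrite (bigD1 i) //=; congr addn; apply: eq_bigl => k; rewrite eq_sym.
apply: leq_add.
  rewrite -sum_nat_const; apply: leq_sum => i _; rewrite /J.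
  by under eq_bigr do rewrite andbb; rewrite sum_arcs_through_point //; lia.
under [leqRHS]eq_bigr do rewrite card_predE.
rewrite [leqRHS]exchange_big [leqLHS]big_mkcond; apply: leq_sum => p _ /=.
case: ifP => hp //; apply: leq_arcs_through_pair => // j h1 h2.
exact: hP.
Qed.

(** An arc with p <= j and j + L <= q does not wrap around and stays inside
    [p, q), so it only sees points of that block, each of them in at most [L]
    arcs. *)
Lemma sum_arcs_inside n (I : finType) (b : I -> 'I_n.+1) (L p q : nat) :
  (q <= n.+1)%N ->
  (\sum_(j : 'I_n.+1 | (p <= j)%N && (j + L <= q)) arc_count b L j
     <= #|[pred i | p <= b i < q]| * L)%N.
Proof.
move=> hq; case: (leqP L n.+1) => hL; last first.
  by rewrite big1 // => j /andP[_ h]; lia.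
under eq_bigr do rewrite /arc_count card_predE.
rewrite card_predE big_distrl exchange_big; apply: leq_sum => i _; rewrite [X in (_ <= X * _)%N]/=.
case: (boolP (p <= b i < q)%N) => hb.
  rewrite mul1n -[leqRHS](sum_arcs_through_point (b i) hL) big_mkcond.
  by apply: leq_sum => j _ /=; case: ifP.
rewrite big1 // => j /andP[h1 h2]; apply/eqP; rewrite eqb0 -leqNgt.
have := val_subZp_add (b i) j; move: hb h1 h2 hq; clear.
move: (nat_of_ord (b i - j)%R) (nat_of_ord (b i)) (nat_of_ord j) => u v w.
by move=> ? ? ? ? [] ?; lia.
Qed.

Lemma card_arcs_inside n (L p q : nat) : (0 < L)%N -> (q <= n.+1)%N ->
  (q.+1 <= #|[pred j : 'I_n.+1 | (p <= j)%N && (j + L <= q)%N]| + p + L)%N.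
Proof.
case: L => [//|L] _ hq.
set W := [pred j : 'I_n.+1 | _].
suff : (q.+1 - p - L.+1 <= #|W|)%N by clear; lia.
rewrite -[leqLHS]card_ord.
have hf (s : 'I_(q.+1 - p - L.+1)) : (p + s < n.+1)%N.
  by have := ltn_ord s; lia.
rewrite -(card_imset predT (f := fun s => Ordinal (hf s))); last first.
  by move=> s s' /(congr1 val) /= e; apply: val_inj; move: e => /=; lia.
apply: subset_leq_card; apply/fintype.subsetP => j /imsetP[s _ ->].
by rewrite !inE /=; have := ltn_ord s; lia.
Qed.

(** * From the variance of arc counts to block counts *)

(** As many points as boxes means that the average of [arc_count] is [L], so
    this is the usual formula for a variance. *)
Lemma sum_sq_dev_arc_count (R : realType) n (I : finType) (b : I -> 'I_n.+1)
    (L : nat) : #|I| = n.+1 -> (L <= n.+1)%N ->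
  \sum_j ((arc_count b L j)%:R - L%:R) ^+ 2 =
    (\sum_j arc_count b L j ^ 2)%:R - n.+1%:R * L%:R ^+ 2 :> R.
Proof.
move=> hI hL.
under [LHS]eq_bigr do rewrite sqrrB -natrX -mulrnAr.
rewrite big_split sumrB -mulr_suml -!natr_sum /= sum_arc_count // hI.
by rewrite sumr_const card_ord natrM -mulr_natr; ring.
Qed.

(** Cauchy-Schwarz, in a form without square roots: applied termwise, the
    inequality f <= (N / 2B) f^2 + B / 2N sums to at most B / 2 + B / 2. *)
Lemma sum_le_of_sum_sq_le (R : realType) (T : finType) (W : pred T)
    (f : T -> R) (B : R) : (0 < #|T|)%N -> 0 < B ->
  #|T|%:R * (\sum_t f t ^+ 2) <= B ^+ 2 -> \sum_(t in W) f t <= B.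
Proof.
move=> T0 B0 hB; set N : R := #|T|%:R in hB *.
have N0 : 0 < N by rewrite ltr0n.
have Nn0 : N != 0 by rewrite gt_eqF.
have Bn0 : B != 0 by rewrite gt_eqF.
have amgm t : f t <= N / (2 * B) * f t ^+ 2 + B / (2 * N).
  rewrite -subr_ge0.
  have -> : N / (2 * B) * f t ^+ 2 + B / (2 * N) - f t =
      (N * f t - B) ^+ 2 / (2 * B * N) by field; rewrite ?Nn0 ?Bn0.
  by rewrite divr_ge0 ?sqr_ge0 // !mulr_ge0 // ltW.
apply: (@le_trans _ _ (\sum_t (N / (2 * B) * f t ^+ 2 + B / (2 * N)))).
  rewrite big_mkcond; apply: ler_sum => t _; case: ifP => _; first exact: amgm.
  have [NR BR] := (ltW N0, ltW B0).
  by rewrite addr_ge0 // !(sqr_ge0, invr_ge0, mulr_ge0).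
rewrite big_split -mulr_sumr sumr_const -[_ *+ #|_|]mulr_natr -/N /=.
have -> : N / (2 * B) * (\sum_t f t ^+ 2) + B / (2 * N) * N =
    (N * (\sum_t f t ^+ 2) + B ^+ 2) / (2 * B) by field; rewrite ?Nn0 ?Bn0.
by rewrite ler_pdivrMr ?mulr_gt0 //; move: hB; rewrite expr2; lra.
Qed.

(** Only a lower bound is proved: the arcs inside the block never wrap around,
    whereas an upper bound would need arcs that stick out of it. The upper
    bound for [0, a) comes from the lower bound for its complement. The
    expected count q - p loses L - 1 because a block of q - p boxes contains
    only q - p - L + 1 arcs of length L. *)
Lemma interval_count_ge (R : realType) n (I : finType) (b : I -> 'I_n.+1)
    (L p q : nat) (B : R) : (0 < L)%N -> (q <= n.+1)%N -> 0 < B ->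
  n.+1%:R * (\sum_j ((arc_count b L j)%:R - L%:R) ^+ 2) <= B ^+ 2 ->
  q%:R + 1 - p%:R - L%:R - B / L%:R <= #|[pred i | (p <= b i < q)%N]|%:R.
Proof.
move=> L0 hq B0 hB.
have LR : 0 < L%:R :> R by rewrite ltr0n.
pose W := [pred j : 'I_n.+1 | (p <= j)%N && (j + L <= q)%N].
have hW : q%:R + 1 <= #|W|%:R + p%:R + L%:R :> R.
  by rewrite natr1 -!natrD ler_nat card_arcs_inside.
have hS : \sum_(j in W) (arc_count b L j)%:R <=
    #|[pred i | (p <= b i < q)%N]|%:R * L%:R :> R.
  by rewrite -natr_sum -natrM ler_nat sum_arcs_inside.
have : \sum_(j in W) (L%:R - (arc_count b L j)%:R) <= B.
  apply: sum_le_of_sum_sq_le => //; rewrite card_ord //.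
  by under eq_bigr do rewrite -sqrrN opprB.
rewrite sumrB sumr_const -[_ *+ _]mulr_natr => hD.
rewrite -(ler_pM2r LR) mulrBl divfK ?gt_eqF //.
have := ler_wpM2r (ltW LR) hW; lra.
Qed.

(** * Boxes of length 1/N and the star-discrepancy *)

Definition box (R : realType) (x : nat -> R) n (i : 'I_n.+1) : 'I_n.+1 :=
  inord (Num.truncn (n.+1%:R * x i.+1)).

Lemma box_itv (R : realType) (x : nat -> R)
    (x_range : forall n : nat, (0 < n)%N -> 0 <= x n < 1) n (i : 'I_n.+1) :
  (box x i)%:R <= n.+1%:R * x i.+1 < (box x i)%:R + 1.
Proof.
have /andP[x0 x1] := x_range _ (ltn0Sn i).
have /truncn_itv/andP[h1 h2] : 0 <= n.+1%:R * x i.+1 by rewrite mulr_ge0.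
rewrite /box inordK; first by rewrite h1 natr1.
by rewrite -(ltr_nat R); apply: le_lt_trans h1 _; rewrite gtr_pMr // ltr0n.
Qed.

Lemma nearest_int_dist_le (R : realType) (y : R) (k : int) : nearest_int_dist y <= `|y - k%:~R|.
Proof.
apply: ge_inf; last by exists k.
by exists 0 => _ [l _ <-].
Qed.

Lemma val_subZp_int (R : realType) n (a c : 'I_n.+1) :
  exists k : int, (a - c)%R%:R + c%:R = a%:R + k%:~R * n.+1%:R :> R.
Proof.
case: (val_subZp_add a c) => h; [exists 0 | exists 1];
  by rewrite -natrD h ?natrD ?mul0r ?addr0 ?mul1r.
Qed.

(** Two points at box offsets u and v from [j] differ, up to an integer, by
    less than (|u - v| + 1) / N, and |u - v| <= maxn u v. This wasteful bound
    is the one for which the charge of [leq_arcs_through_pair] is injective. *)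
Lemma nearest_int_dist_in_arc (R : realType) (x : nat -> R)
    (x_range : forall n : nat, (0 < n)%N -> 0 <= x n < 1) n (i k j : 'I_n.+1) :
  nearest_int_dist (x i.+1 - x k.+1) <
    (maxn (box x i - j)%R (box x k - j)%R).+1%:R / n.+1%:R.
Proof.
have [l hl] := val_subZp_int R (box x i) j; have [m hm] := val_subZp_int R (box x k) j.
have /andP[i1 i2] := box_itv x_range i; have /andP[k1 k2] := box_itv x_range k.
apply: le_lt_trans (nearest_int_dist_le _ (m - l)) _.
rewrite ltr_pdivlMr ?ltr0n // -[X in _ * X]ger0_norm // -normrM intrB.
move: hl hm; move: (nat_of_ord (box x i - j)) (nat_of_ord (box x k - j)) => u v hl hm.
have hu : u%:R <= (maxn u v)%:R :> R by rewrite ler_nat leq_maxl.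
have hv : v%:R <= (maxn u v)%:R :> R by rewrite ler_nat leq_maxr.
have u0 : 0 <= u%:R :> R by []. have v0 : 0 <= v%:R :> R by [].
rewrite -[(maxn u v).+1%:R]natr1 ltr_norml; apply/andP; split; lra.
Qed.

(** The pair bounds 2s(N + F) add up to L(L+1)(N + F), and the NL^2 in
    L(L+1)N cancels against the mean: V is of order LN + L^2 F instead of
    L^2 N. *)
Lemma sum_sq_dev_box_le (R : realType) (x : nat -> R)
    (x_range : forall n : nat, (0 < n)%N -> 0 <= x n < 1)
    n (L : nat) (F : R) : (0 < L)%N -> (L + L <= n.+1)%N ->
  (forall s, (0 < s <= L)%N ->
     (pair_count x n.+1 s)%:R <= 2 * s%:R * (n.+1%:R + F)) ->
  \sum_j ((arc_count (@box _ x n) L j)%:R - L%:R) ^+ 2 <=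
    2 * L%:R * n.+1%:R + L%:R * (L%:R + 1) * F.
Proof.
move=> L0 hL hP.
rewrite sum_sq_dev_arc_count ?card_ord //; last by lia.
pose P (p : 'I_n.+1 * 'I_n.+1) (s : nat) :=
  nearest_int_dist (x p.1.+1 - x p.2.+1) < s.+1%:R / n.+1%:R.
have := @sum_arc_count_sq n _ (@box _ x n) L P hL
  (fun p j _ _ => nearest_int_dist_in_arc x_range p.1 p.2 j).
rewrite card_ord -(ler_nat R) natrD natrM [X in _ + X]natr_sum => hsq.
have hsum : \sum_(s < L) #|[pred p | (p.1 != p.2) && P p s]|%:R <=
    \sum_(s < L) 2 * s.+1%:R * (n.+1%:R + F).
  by apply: ler_sum => s _; apply: (hP s.+1); rewrite ltn_ord.
have gauss : \sum_(s < L) 2 * s.+1%:R * (n.+1%:R + F) =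
    L%:R * (L%:R + 1) * (n.+1%:R + F).
  rewrite -mulr_suml; congr (_ * _).
  elim: (L) => [|m IH]; first by rewrite big_ord0 mul0r.
  by rewrite big_ord_recr IH /= -natr1; ring.
rewrite gauss in hsum.
have := le_trans hsq (lerD (lexx _) hsum); lra.
Qed.

(** The lower bound counts the boxes that lie entirely in [0, a), namely those
    before [q = floor (N a)]; the upper bound discards the boxes from [q.+1] on,
    which lie entirely in [a, 1). The rounding errors are absorbed by the
    summand + 1 in [interval_count_ge]. *)
Lemma visit_count_near (R : realType) (x : nat -> R)
    (x_range : forall n : nat, (0 < n)%N -> 0 <= x n < 1)
    n (L : nat) (B a : R) : (0 < L)%N -> 0 < B ->
  n.+1%:R * (\sum_j ((arc_count (@box _ x n) L j)%:R - L%:R) ^+ 2) <= B ^+ 2 ->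
  0 <= a <= 1 ->
  `|(visit_count x n.+1 a)%:R - n.+1%:R * a| <= L%:R + B / L%:R.
Proof.
move=> L0 B0 hB /andP[a0 a1].
have N0 : 0 < n.+1%:R :> R by rewrite ltr0n.
have Na0 : 0 <= n.+1%:R * a by rewrite mulr_ge0.
have /andP[q1 q2] := truncn_itv Na0; set q := Num.truncn _ in q1 q2.
have hq : (q <= n.+1)%N.
  by rewrite -(ler_nat R); apply: le_trans q1 _; rewrite ger_pMr.
rewrite ler_norml; apply/andP; split.
  have := interval_count_ge 0 L0 hq B0 hB.
  have : #|[pred i : 'I_n.+1 | (0 <= box x i < q)%N]|%:R <= (visit_count x n.+1 a)%:R :> R.
    rewrite ler_nat; apply: subset_leq_card; apply/fintype.subsetP => i.
    rewrite !unfold_in /= => hi.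
    have /andP[x0 _] := x_range _ (ltn0Sn i); rewrite x0 /=.
    have /andP[_ h] := box_itv x_range i.
    have : (box x i).+1%:R <= q%:R :> R by rewrite ler_nat.
    rewrite -natr1 -(ltr_pM2l N0); lra.
  move: q2; rewrite -natr1; lra.
have := interval_count_ge q.+1 L0 (leqnn n.+1) B0 hB.
have : (visit_count x n.+1 a + #|[pred i : 'I_n.+1 | (q.+1 <= box x i < n.+1)%N]|)%:R
    <= n.+1%:R :> R.
  rewrite ler_nat -[leqRHS]card_ord.
  rewrite -(cardC [pred i : 'I_n.+1 | (0 <= x i.+1) && (x i.+1 < a)]) leq_add2l.
  apply: subset_leq_card; apply/fintype.subsetP => i.
  rewrite !unfold_in /= => /andP[hi _]; rewrite negb_and -leNgt; apply/orP; right.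
  have /andP[h _] := box_itv x_range i.
  have hqb : q.+1%:R <= (box x i)%:R :> R by rewrite ler_nat.
  by rewrite -(ler_pM2l N0) (le_trans (ltW q2)) // (le_trans hqb).
rewrite natrD; move: q1; rewrite -[q.+1%:R]natr1; lra.
Qed.

Lemma star_discrepancy_le (R : realType) (x : nat -> R)
    (x_range : forall n : nat, (0 < n)%N -> 0 <= x n < 1)
    n (L : nat) (B : R) : (0 < L)%N -> 0 < B ->
  n.+1%:R * (\sum_j ((arc_count (@box _ x n) L j)%:R - L%:R) ^+ 2) <= B ^+ 2 ->
  n.+1%:R * star_discrepancy x n.+1 <= L%:R + B / L%:R.
Proof.
move=> L0 B0 hB; have N0 : 0 < n.+1%:R :> R by rewrite ltr0n.
rewrite mulrC -ler_pdivlMr //; apply: ge_sup.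
  by exists `| 1 / n.+1%:R * (visit_count x n.+1 0)%:R - 0 |; exists 0; rewrite //= lexx ler01.
move=> _ [a ha <-]; rewrite ler_pdivlMr //.
apply: le_trans (visit_count_near x_range L0 B0 hB ha).
rewrite -[X in _ * X]ger0_norm // -normrM.
by rewrite mulrBl div1r mulrAC mulVf ?gt_eqF // mul1r [a * _]mulrC.
Qed.

(** * The scale L = K^2 *)

Lemma pair_count_le (R : realType) (x : nat -> R) (N K s : nat) (F : R) :
  pair_deviation x K N <= F -> (0 < s <= K)%N ->
  (pair_count x N s)%:R <= 2 * s%:R * (N%:R + F).
Proof.
move=> hF /andP[s0 sK].
have sR : 0 < 2 * s%:R :> R by rewrite mulr_gt0 ?ltr0n.
have : `|1 / (2 * s%:R) * (pair_count x N s)%:R - N%:R| <= F.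
  apply: le_trans hF.
  apply: (le_bigmax_seq (0 : R) s xpredT
    (fun s => `|1 / (2 * s%:R) * (pair_count x N s)%:R - N%:R|)) => //.
  by rewrite mem_index_iota ltnS s0.
move=> /(le_trans (ler_norm _)); rewrite div1r lerBlDr mulrC ler_pdivrMr //; lra.
Qed.

(** With t = N^(1/5) and k = K, the left-hand side is N times the bound on V.
    The point is that N <= M k. If k >= t^2 / 2 then M k >= t^6 / 2 >= t^5 = N,
    because t >= 2. If k >= N / F then N^2 <= k N F <= k M^2 <= (M k)^2. Dividing
    by k^2, the claim becomes 2 N^2 + (k^2 + 1) N F <= 4 M^2 k^2, where each of
    the two terms is at most 2 M^2 k^2. *)
Lemma arc_scale_bound (R : realType) (N t F M k : R) :
  0 < F -> 2 <= t -> N = t ^+ 5 -> 1 <= k ->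
  Num.min (1 / 2 * t ^+ 2) (N / F) <= k ->
  t ^+ 4 <= M -> N * F <= M ^+ 2 ->
  N * (2 * k ^+ 2 * N + k ^+ 2 * (k ^+ 2 + 1) * F) <= (2 * M * k ^+ 2) ^+ 2.
Proof.
move=> F0 t2 hN k1 hk tM FM.
have N0 : 0 < N by rewrite hN exprn_gt0; lra.
have t4 : 0 < t ^+ 4 by rewrite exprn_gt0; lra.
have M0 : 0 < M by lra.
have k0 : 0 < k by lra.
have NR := ltW N0; have MR := ltW M0; have kR := ltW k0.
have NMk : N <= M * k.
  move: hk; rewrite ge_min => /orP[hk|].
    apply: le_trans (ler_pM (ltW t4) _ tM hk).
      rewrite hN (_ : _ * _ = t ^+ 5 * (t / 2)); last by field.
      by rewrite ler_peMr; [|rewrite exprn_ge0; lra|lra].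
    by rewrite mulr_ge0 ?exprn_ge0; lra.
  rewrite ler_pdivrMr // => hNF.
  rewrite -(@ler_pXn2r _ 2) ?nnegrE ?mulr_ge0 // exprMn.
  apply: (@le_trans _ _ (k * M ^+ 2)).
    apply: (@le_trans _ _ (k * (N * F))); last by rewrite ler_pM2l.
    by rewrite expr2 mulrCA ler_pM2l.
  by rewrite mulrC ler_pM2l ?exprn_gt0 // expr2 ler_peMl // ltW.
have k2 : 1 <= k ^+ 2 by rewrite exprn_ege1.
have N2 : N ^+ 2 <= M ^+ 2 * k ^+ 2.
  by rewrite -exprMn ler_pXn2r ?nnegrE ?mulr_ge0.
have h : (k ^+ 2 + 1) * (N * F) <= 2 * k ^+ 2 * M ^+ 2.
  apply: ler_pM => //; [lra | by rewrite mulr_ge0 ?ltW | lra].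
rewrite (_ : (2 * M * k ^+ 2) ^+ 2 = k ^+ 2 * (4 * M ^+ 2 * k ^+ 2)); last by ring.
rewrite (_ : N * _ = k ^+ 2 * (2 * N ^+ 2 + (k ^+ 2 + 1) * (N * F))); last by ring.
rewrite ler_pM2l; first lra.
by lra.
Qed.

Theorem theorem1 (R : realType) (x : nat -> R)
  (x_range : forall n : nat, (0 < n)%N -> 0 <= x n < 1)
  (F : nat -> nat -> R)
  (F_pos : forall K N : nat, (0 < K)%N -> (0 < N)%N -> 0 < F K N)
  (F_mono : forall K K' N : nat, (0 < K)%N -> (0 < N)%N -> (K <= K')%N ->
     F K N <= F K' N)
  (F_bound : forall N K : nat, (0 < N)%N -> (0 < K)%N ->
     (K%:R : R) <= N%:R / 2 -> pair_deviation x K N <= F K N) :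
  exists N0 : nat, (0 < N0)%N /\
    forall N : nat, (0 < N)%N -> (N0 <= N)%N ->
    forall K : nat, (0 < K)%N ->
      Num.min (1 / 2 * N%:R `^ (2 / 5)) (N%:R / F (K ^ 2)%N N) <= K%:R ->
      K%:R <= N%:R `^ (2 / 5) :> R ->
      N%:R * star_discrepancy x N
        <= 5 * Num.max (N%:R `^ (4 / 5)) (Num.sqrt (N%:R * F (K ^ 2)%N N)).
Proof.
exists 32%N; split=> // -[//|n] _ hn K K0.
set f := F _ _; set t : R := n.+1%:R `^ (1 / 5).
have t0 : 0 <= t by exact: powR_ge0.
have tX m : n.+1%:R `^ (m%:R / 5) = t ^+ m.
  by rewrite -powR_mulrn // -powRrM mulrC div1r.
have t5 : n.+1%:R = t ^+ 5 by rewrite -tX divff // powRr1.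
rewrite !tX; set M := Num.max _ _ => hmin hmax.
have t2 : 2 <= t.
  rewrite -(@ler_pXn2r _ 5) ?nnegrE // -t5 -natrX ler_nat.
  exact: hn.
have K1 : 1 <= K%:R :> R by rewrite ler1n.
have K2 : (K ^ 2)%N%:R <= t ^+ 4.
  by rewrite natrX (exprM t 2 2) ler_pXn2r ?nnegrE ?exprn_ge0.
have KN : (K ^ 2)%N%:R <= n.+1%:R / 2 :> R.
  rewrite ler_pdivlMr // t5 exprSr; apply: ler_pM => //.
have L0 : (0 < K ^ 2)%N by rewrite expn_gt0 K0.
have LN : (K ^ 2 + K ^ 2 <= n.+1)%N.
  by rewrite -(ler_nat R) natrD; lra.
have f0 : 0 < f by apply: F_pos.
have tM : t ^+ 4 <= M by rewrite le_max lexx.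
have fM : n.+1%:R * f <= M ^+ 2.
  rewrite -(@sqr_sqrtr _ (n.+1%:R * f)) ?mulr_ge0 ?(ltW f0) //.
  rewrite ler_pXn2r ?nnegrE ?sqrtr_ge0 //; first by rewrite le_max lexx orbT.
  by apply: le_trans tM; rewrite exprn_ge0.
have M0 : 0 < M by apply: lt_le_trans tM; rewrite exprn_gt0 //; lra.
(* B / L = 2 M for this choice of B as a bound for sqrt (N V). *)
have B0 : 0 < 2 * M * (K ^ 2)%N%:R by rewrite !mulr_gt0 // ltr0n.
have hdev := F_bound n.+1 (K ^ 2)%N isT L0 KN.
have V := sum_sq_dev_box_le x_range L0 LN (fun s => pair_count_le hdev).
have hV : n.+1%:R * (2 * (K ^ 2)%N%:R * n.+1%:R +
    (K ^ 2)%N%:R * ((K ^ 2)%N%:R + 1) * f) <= (2 * M * (K ^ 2)%N%:R) ^+ 2.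
  by rewrite natrX; apply: (@arc_scale_bound _ _ t).
have := star_discrepancy_le x_range L0 B0 (le_trans (ler_wpM2l (ler0n _ _) V) hV).
rewrite mulfK ?gt_eqF ?ltr0n //; lra.
Qed.
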